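(* Let $(Q,c)\in\mathcal{S}^n\times\mathbb{R}^n$. Then $\ell_R(\cdot)$ is a piecewise linear convex function on $F$ given by $$\ell_R(\hat x)=\frac12\left(\sum_{(i,j):Q_{ij}>0}Q_{ij}\max\{0,\hat x_i+\hat x_j-1\}+\sum_{(i,j):Q_{ij}<0}Q_{ij}\min\{\hat x_i,\hat x_j\}\right)+c^T\hat x,\quad \hat x\in F,$$ where the sums run over ordered pairs $(i,j)\in\{1,\dots,n\}^2$.
   Context: Let $n \ge 1$, let $\mathcal{S}^n$ be the space of real symmetric $n\times n$ matrices, $e \in \mathbb{R}^n$ the all-ones vector, $\langle A,B\rangle = \mathrm{trace}(A^TB)$. Let $F = \{x \in \mathbb{R}^n : 0 \le x \le e\}$ (componentwise) and $$\mathcal{F}_R = \{(x,X)\in\mathbb{R}^n\times\mathcal{S}^n : 0\le x\le e,\ \max\{x_i+x_j-1,0\}\le X_{ij}\le \min\{x_i,x_j\},\ 1\le i\le j\le n\}.$$ For $\hat x\in F$, $\ell_R(\hat x)=\min\{\frac12\langle Q,X\rangle+c^T\hat x : X\in\mathcal{S}^n,\ (\hat x,X)\in\mathcal{F}_R\}$. *)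

(* Defs.v *)
From HB Require Import structures.
From mathcomp Require Import all_boot all_order all_algebra.
From mathcomp Require Import mathcomp_extra boolp classical_sets reals convex.

Set Implicit Arguments.
Unset Strict Implicit.
Unset Printing Implicit Defensive.

Import Order.TTheory GRing.Theory Num.Theory.
Local Open Scope classical_set_scope.
Local Open Scope ring_scope.

Definition dot (R : realType) (n : nat) (u v : 'cV[R]_n) : R :=
  (u^T *m v) 0 0.

Definition mxdot (R : realType) (n : nat) (A B : 'M[R]_n) : R :=
  \tr (A^T *m B).

Definition box (R : realType) (n : nat) : set 'cV[R]_n :=
  [set x | forall i, 0 <= x i 0 <= 1].
Arguments box : clear implicits.

Definition FR (R : realType) (n : nat) : set ('cV[R]_n * 'M[R]_n) :=
  [set xX : 'cV[R]_n * 'M[R]_n |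
           [/\ xX.2 \is symmetricmx,
                box R n xX.1
              & forall i j : 'I_n, (i <= j)%N ->
                  Num.max (xX.1 i 0 + xX.1 j 0 - 1) 0 <= xX.2 i j
                    <= Num.min (xX.1 i 0) (xX.1 j 0)]].
Arguments FR : clear implicits.

Definition is_minimum (R : realType) (S : set R) (m : R) : Prop :=
  S m /\ lbound S m.

Definition ellR_values (R : realType) (n : nat) (Q : 'M[R]_n) (c : 'cV[R]_n)
    (x : 'cV[R]_n) : set R :=
  [set 2^-1 * mxdot Q X + dot c x | X in [set X | FR R n (x, X)]].

(* [inf] of a set that is empty or unbounded below is a junk value, so it is
   the minimum only where [is_minimum (ellR_values Q c x) (ellR Q c x)]. *)
Definition ellR (R : realType) (n : nat) (Q : 'M[R]_n) (c : 'cV[R]_n)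
    (x : 'cV[R]_n) : R :=
  inf (ellR_values Q c x).

Definition polyhedron (R : realType) (n : nat) (P : set 'cV[R]_n) : Prop :=
  exists (m : nat) (A : 'M[R]_(m, n)) (b : 'cV[R]_m),
    P = [set x | forall k, (A *m x) k 0 <= b k 0].

(* As usual, "linear" on a piece allows a constant term. The pieces are closed
   and finitely many, so a piecewise linear function on D is continuous on D. *)
Definition piecewise_linear (R : realType) (n : nat) (D : set 'cV[R]_n)
    (f : 'cV[R]_n -> R) : Prop :=
  exists (m : nat) (P : 'I_m -> set 'cV[R]_n) (a : 'I_m -> 'cV[R]_n)
      (b : 'I_m -> R),
    [/\ forall k, polyhedron (P k),
        D = \bigcup_k P k
      & forall k x, P k x -> f x = dot (a k) x + b k].

(* Main.v *)
Require Import Defs.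
From mathcomp Require Import all_boot all_order all_algebra.
From mathcomp Require Import mathcomp_extra boolp classical_sets reals convex.
From mathcomp Require Import interval_inference.
From mathcomp Require Import lra.

Set Implicit Arguments.
Unset Strict Implicit.
Unset Printing Implicit Defensive.

Import Order.TTheory GRing.Theory Num.Theory.
Local Open Scope classical_set_scope.
Local Open Scope ring_scope.

(** Write [<Q, X>] as the sum over ordered pairs of [Q i j * X i j]. At a
    given [x] in the box, the entries of a feasible [X] range independently (up
    to symmetry) over the intervals from [max (x i + x j - 1) 0] to
    [min (x i) (x j)], so the sum is minimized entry by entry: take the lower
    end where [Q i j > 0] and the upper end elsewhere ([ellR_argmin]). Symmetry
    of [Q] makes this choice symmetric, hence feasible ([ellR_argmin_feasible]),
    and that is the closed formula ([ellR_values_minimum]).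

    For the shape of the function, [q * max 0 u] with [q > 0] and
    [q * min u v = max (q u) (q v)] with [q < 0] are both maxima of two affine
    functions. A sum of maxima of finitely many affine functions is again such
    a maximum, over the choices of one function from each family, so the
    formula is a maximum of finitely many affine functions on the whole space
    ([max_affine_ellR_formula]). Such a maximum is convex, and it is piecewise
    linear on any polyhedron, the pieces being the regions where a given affine
    function dominates all the others ([convex_function_max_affine],
    [piecewise_linear_max_affine]). *)

(** * Dot product and polyhedra *)

Section Polyhedra.
Context {R : realType} {n : nat}.
Implicit Types (u v x : 'cV[R]_n) (k : R).

Lemma dotE u v : dot u v = \sum_i u i 0 * v i 0.
Proof. by rewrite /dot mxE; apply: eq_bigr => i _; rewrite mxE. Qed.

Lemma dotDl u v x : dot (u + v) x = dot u x + dot v x.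
Proof. by rewrite /dot linearD mulmxDl mxE. Qed.

Lemma dotNl u x : dot (- u) x = - dot u x.
Proof. by rewrite /dot linearN mulNmx mxE. Qed.

Lemma dotZl k u x : dot (k *: u) x = k * dot u x.
Proof. by rewrite /dot linearZ /= -scalemxAl mxE. Qed.

Lemma dotDr u v x : dot x (u + v) = dot x u + dot x v.
Proof. by rewrite /dot mulmxDr mxE. Qed.

Lemma dotZr k u x : dot x (k *: u) = k * dot x u.
Proof. by rewrite /dot -scalemxAr mxE. Qed.

Lemma dot0l x : dot 0 x = 0.
Proof. by rewrite /dot trmx0 mul0mx mxE. Qed.

Lemma dot_delta i x : dot (delta_mx i 0) x = x i 0.
Proof. by rewrite /dot trmx_delta -rowE mxE. Qed.

(** Indexing the inequalities by any finite type, not by an initial segment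
    of the integers, lets systems be written in their natural indices, such as
    pairs of a coordinate and a side. *)
Lemma polyhedron_fin (I : finType) (a : I -> 'cV[R]_n) (b : I -> R) :
  polyhedron [set x | forall i, dot (a i) x <= b i].
Proof.
exists #|I|, (\matrix_k (a (enum_val k))^T), (\col_k b (enum_val k)).
have mulE (k : 'I_#|I|) x : ((\matrix_k (a (enum_val k))^T) *m x) k 0 =
    dot (a (enum_val k)) x.
  by rewrite mxE dotE; apply: eq_bigr => j _; rewrite !mxE.
apply/seteqP; split => x /= h i; first by rewrite mulE mxE.
by have := h (enum_rank i); rewrite mulE mxE enum_rankK.
Qed.

Lemma polyhedronI (P1 P2 : set 'cV[R]_n) :
  polyhedron P1 -> polyhedron P2 -> polyhedron (P1 `&` P2).
Proof.
move=> [m1 [A1 [b1 ->]]] [m2 [A2 [b2 ->]]].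
exists (m1 + m2)%N, (col_mx A1 A2), (col_mx b1 b2).
apply/seteqP; split => x /=.
  by move=> [h1 h2] k; rewrite mul_col_mx !mxE; case: split => j;
    [exact: h1|exact: h2].
move=> h; split => k.
  by have := h (lshift m2 k); rewrite mul_col_mx !col_mxEu.
by have := h (rshift m1 k); rewrite mul_col_mx !col_mxEd.
Qed.

Lemma polyhedron_box : polyhedron (box R n).
Proof.
pose a (p : 'I_n * bool) : 'cV[R]_n :=
  if p.2 then delta_mx p.1 0 else - delta_mx p.1 0.
pose b (p : 'I_n * bool) : R := if p.2 then 1 else 0.
suff -> : box R n = [set x | forall p, dot (a p) x <= b p].
  exact: polyhedron_fin.
apply/seteqP; split => x /= h.
  by move=> [i []]; rewrite /a /b /= ?dotNl dot_delta ?oppr_le0;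
    have /andP[] := h i.
move=> i; have := h (i, true); have := h (i, false).
by rewrite /a /b /= dotNl !dot_delta oppr_le0 => -> ->.
Qed.

Lemma convex_set_box : convex_set (box R n).
Proof.
move=> x y t; rewrite !inE => hx hy i.
have -> : (conv t x y : 'cV[R]_n) i 0 = t%:num * x i 0 + (1 - t%:num) * y i 0.
  by rewrite !mxE.
have /andP[x0 x1] := hx i; have /andP[y0 y1] := hy i.
have t0 : 0 <= t%:num by [].
have t1 : t%:num <= 1 by [].
by apply/andP; split; nra.
Qed.

End Polyhedra.

(** * Maxima of finitely many affine functions *)

Section MaxAffine.
Context {R : realType} {n : nat}.
Implicit Types (f g : 'cV[R]_n -> R) (D : set 'cV[R]_n).
Implicit Types (a : 'cV[R]_n) (b k : R).

(** The maximum is described by its two defining properties, upper bound and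
    attained value, which compose better than an iterated maximum: no default
    value for an empty family has to be chosen. *)
Definition max_affine (f : 'cV[R]_n -> R) :=
  exists (I : finType) (a : I -> 'cV[R]_n) (b : I -> R), forall x,
    (forall i, dot (a i) x + b i <= f x) /\ exists i, f x = dot (a i) x + b i.

Lemma max_affine_ext f g : max_affine f -> f =1 g -> max_affine g.
Proof. by move=> + /funext <-. Qed.

Lemma max_affine_affine a b : max_affine (fun x => dot a x + b).
Proof. by exists unit, (fun=> a), (fun=> b) => x; split=> //; exists tt. Qed.

Lemma max_affine_max f g : max_affine f -> max_affine g ->
  max_affine (fun x => Num.max (f x) (g x)).
Proof.
move=> [I [a [b hf]]] [J [c [d hg]]].
pose u (s : I + J) := match s with inl i => a i | inr j => c j end.
pose w (s : I + J) := match s with inl i => b i | inr j => d j end.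
exists (I + J)%type, u, w => x.
have [[fub [i fi]] [gub [j gj]]] := (hf x, hg x); split.
  by case=> k /=; rewrite le_max ?fub ?gub ?orbT.
have [fg|gf] := leP (f x) (g x); first by exists (inr j).
by exists (inl i).
Qed.

Lemma max_affineD f g : max_affine f -> max_affine g ->
  max_affine (fun x => f x + g x).
Proof.
move=> [I [a [b hf]]] [J [c [d hg]]].
exists (I * J)%type, (fun p => a p.1 + c p.2), (fun p => b p.1 + d p.2) => x.
have [[fub [i fi]] [gub [j gj]]] := (hf x, hg x); split.
  by move=> p; rewrite dotDl addrACA lerD.
by exists (i, j); rewrite fi gj dotDl /= addrACA.
Qed.

Lemma max_affineZ k f : 0 <= k -> max_affine f ->
  max_affine (fun x => k * f x).
Proof.
move=> k0 [I [a [b hf]]].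
exists I, (fun i => k *: a i), (fun i => k * b i) => x.
have [fub [i fi]] := hf x; split; last by exists i; rewrite dotZl -mulrDr fi.
by move=> j; rewrite dotZl -mulrDr ler_wpM2l.
Qed.

Lemma max_affine_sum (I : Type) (r : seq I) (P : pred I)
    (f : I -> 'cV[R]_n -> R) :
  (forall i, P i -> max_affine (f i)) ->
  max_affine (fun x => \sum_(i <- r | P i) f i x).
Proof.
move=> hf; elim: r => [|i r IH].
  apply: (max_affine_ext (max_affine_affine 0 0)) => x.
  by rewrite big_nil dot0l addr0.
have [Pi|/negbTE nPi] := boolP (P i).
  apply: (max_affine_ext (max_affineD (hf i Pi) IH)) => x.
  by rewrite big_cons Pi.
by apply: (max_affine_ext IH) => x; rewrite big_cons nPi.
Qed.

(** The piece of index [i] is where the [i]-th affine function dominates all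
    the others, and thus equals their maximum. *)
Lemma piecewise_linear_max_affine D f g :
  polyhedron D -> max_affine f -> {in D, g =1 f} -> piecewise_linear D g.
Proof.
move=> polyD [I [a [b hf]]] gf.
pose P i := D `&` [set x | forall j, dot (a j - a i) x <= b i - b j].
have PE i x : P i x <->
    D x /\ forall j, dot (a j) x + b j <= dot (a i) x + b i.
  by split=> -[Dx h]; split=> // j; have := h j; rewrite dotDl dotNl; lra.
exists #|I|, (P \o enum_val), (a \o enum_val), (b \o enum_val); split.
- by move=> k; apply: polyhedronI => //; exact: polyhedron_fin.
- apply/seteqP; split=> [x Dx|x [k _ []//]].
  have [fub [i fi]] := hf x.
  exists (enum_rank i) => //=; rewrite enum_rankK; apply/PE; split=> // j.
  by rewrite -fi.
- move=> k x /PE[Dx dom]; rewrite gf ?inE//.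
  have [fub [i fi]] := hf x.
  by apply/eqP; rewrite eq_le fub fi dom.
Qed.

(** At a convex combination [z] of [x] and [y], the maximum is attained by one
    affine function, whose value at [z] is the combination of its values at [x]
    and [y], and these are at most the values of the maximum there. *)
Lemma convex_function_max_affine D f g :
  convex_set D -> max_affine f -> {in D, g =1 f} -> convex_function D g.
Proof.
move=> cvxD [I [a [b hf]]] gf t x y Dx Dy.
rewrite (gf x Dx) (gf y Dy) (gf _ (cvxD x y t Dx Dy)).
have [_ [i ->]] := hf (conv t x y).
have [/(_ i) fx _] := hf x; have [/(_ i) fy _] := hf y.
have -> : dot (a i) (conv t x y) =
    t%:num * dot (a i) x + (1 - t%:num) * dot (a i) y.
  by rewrite dotDr !dotZr.
rewrite (_ : conv t (f x : R^o) (f y : R^o) =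
    t%:num * f x + (1 - t%:num) * f y)//.
have t0 : 0 <= t%:num by [].
have t1 : t%:num <= 1 by [].
nra.
Qed.

End MaxAffine.

(** * The minimum of the relaxation *)

Section Relaxation.
Context {R : realType} {n : nat}.
Implicit Types (Q X : 'M[R]_n) (c x : 'cV[R]_n).

Lemma symmetricmxP X : reflect (forall i j, X i j = X j i) (X \is symmetricmx).
Proof.
apply: (iffP (is_hermitianmxP _ _ _)) => [|XT].
  by rewrite expr0 scale1r map_mx_id// => XT i j; rewrite [in LHS]XT mxE.
by apply/matrixP => i j; rewrite expr0 scale1r !mxE.
Qed.

Lemma mxdotE Q X : mxdot Q X = \sum_(ij : 'I_n * 'I_n) Q ij.1 ij.2 * X ij.1 ij.2.
Proof.
rewrite -(pair_bigA _ (fun i j => Q i j * X i j)) /= exchange_big.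
rewrite /mxdot /mxtrace; apply: eq_bigr => j _.
by rewrite mxE; apply: eq_bigr => i _; rewrite mxE.
Qed.

(** The bounds are symmetric in [i] and [j], like [X], so that imposing them
    on the upper triangle imposes them everywhere. *)
Lemma FR_bounds x X : FR R n (x, X) -> forall i j,
  Num.max (x i 0 + x j 0 - 1) 0 <= X i j <= Num.min (x i 0) (x j 0).
Proof.
move=> [/= /symmetricmxP Xsym _ bnd] i j.
have [ij|/ltnW ji] := leqP i j; first exact: bnd.
by rewrite Xsym (addrC (x i 0)) minC bnd.
Qed.

Definition ellR_argmin Q x : 'M[R]_n :=
  \matrix_(i, j) if 0 < Q i j then Num.max (x i 0 + x j 0 - 1) 0
                 else Num.min (x i 0) (x j 0).

(** The lower bound never exceeds the upper one on the box: [u + v - 1] is at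
    most [u] and [v] because [u, v <= 1], and [0] is because [0 <= u, v]. *)
Lemma ellR_argmin_feasible Q x :
  Q \is symmetricmx -> box R n x -> FR R n (x, ellR_argmin Q x).
Proof.
move=> /symmetricmxP Qsym xbox; split=> //=.
  by apply/symmetricmxP => i j; rewrite !mxE Qsym (addrC (x j 0)) minC.
move=> i j _; rewrite mxE.
have /andP[xi0 xi1] := xbox i; have /andP[xj0 xj1] := xbox j.
have le_maxmin : Num.max (x i 0 + x j 0 - 1) 0 <= Num.min (x i 0) (x j 0).
  by rewrite ge_max !le_min xi0 xj0 andbT; apply/andP; split; lra.
by case: ifP; rewrite lexx le_maxmin.
Qed.

Lemma ellR_argmin_le Q x X : FR R n (x, X) ->
  mxdot Q (ellR_argmin Q x) <= mxdot Q X.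
Proof.
move=> feas; rewrite !mxdotE; apply: ler_sum => -[i j] _ /=; rewrite mxE.
have /andP[lo up] := FR_bounds feas i j.
by have [Q0|Q0] := ltP 0 (Q i j); [rewrite ler_pM2l|rewrite ler_wnM2l].
Qed.

Definition ellR_formula Q c x : R :=
  2^-1 * (\sum_(ij : 'I_n * 'I_n | 0 < Q ij.1 ij.2)
             Q ij.1 ij.2 * Num.max 0 (x ij.1 0 + x ij.2 0 - 1)
          + \sum_(ij : 'I_n * 'I_n | Q ij.1 ij.2 < 0)
             Q ij.1 ij.2 * Num.min (x ij.1 0) (x ij.2 0))
  + dot c x.

Lemma ellR_formulaE Q c x :
  ellR_formula Q c x = 2^-1 * mxdot Q (ellR_argmin Q x) + dot c x.
Proof.
rewrite mxdotE /ellR_formula; congr (_ * _ + _).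
rewrite [RHS](bigID (fun ij => 0 < Q ij.1 ij.2)) /=; congr (_ + _).
  by apply: eq_bigr => ij Q0; rewrite mxE Q0 maxC.
rewrite big_mkcond [RHS]big_mkcond; apply: eq_bigr => ij _; rewrite mxE.
by case: ltgtP => //= ->; rewrite mul0r.
Qed.

Lemma ellR_values_minimum Q c x : Q \is symmetricmx -> box R n x ->
  is_minimum (ellR_values Q c x) (ellR_formula Q c x).
Proof.
move=> Qsym xbox; rewrite ellR_formulaE; split.
  by exists (ellR_argmin Q x) => //; exact: ellR_argmin_feasible.
move=> _ [X feas <-]; rewrite lerD2r ler_pM2l ?invr_gt0 ?ltr0n//.
exact: ellR_argmin_le.
Qed.

Lemma inf_minimum (S : set R) m : is_minimum S m -> inf S = m.
Proof.
move=> [Sm lbm]; apply/eqP; rewrite eq_le ge_inf//=; last by exists m.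
by apply: lb_le_inf => //; exists m.
Qed.

Lemma max_affine_ellR_formula Q c : max_affine (ellR_formula Q c).
Proof.
apply: max_affineD; last first.
  by apply: (max_affine_ext (max_affine_affine c 0)) => x; rewrite addr0.
apply: max_affineZ; first by rewrite invr_ge0 ler0n.
apply: max_affineD; apply: max_affine_sum => -[i j] /= Qij.
- apply: max_affineZ; first exact: ltW.
  apply: max_affine_max.
    by apply: (max_affine_ext (max_affine_affine 0 0)) => x; rewrite dot0l addr0.
  apply: (max_affine_ext
    (max_affine_affine (delta_mx i 0 + delta_mx j 0) (-1))) => x.
  by rewrite dotDl !dot_delta.
(* The negative factor turns the minimum, which is concave, into a maximum. *)
- pose affQ (k : 'I_n) := max_affine_affine (Q i j *: delta_mx k 0) 0.
  apply: (max_affine_ext (max_affine_max (affQ i) (affQ j))) => x.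
  by rewrite !addr0 !dotZl !dot_delta minr_nMr// ltW.
Qed.

End Relaxation.

Theorem lemma3p1 (R : realType) (n : nat) (n_ge1 : (1 <= n)%N)
    (Q : 'M[R]_n) (c : 'cV[R]_n) (Qsym : Q \is symmetricmx) :
  [/\ forall x, box R n x -> is_minimum (ellR_values Q c x) (ellR Q c x),
      piecewise_linear (box R n) (ellR Q c),
      convex_function (box R n) (ellR Q c)
    & forall x, box R n x ->
        ellR Q c x =
          2^-1 * (\sum_(ij : 'I_n * 'I_n | 0 < Q ij.1 ij.2)
                     Q ij.1 ij.2 * Num.max 0 (x ij.1 0 + x ij.2 0 - 1)
                  + \sum_(ij : 'I_n * 'I_n | Q ij.1 ij.2 < 0)
                     Q ij.1 ij.2 * Num.min (x ij.1 0) (x ij.2 0))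
          + dot c x].
Proof.
have ellRE x : box R n x -> ellR Q c x = ellR_formula Q c x.
  by move=> xbox; apply: inf_minimum; exact: ellR_values_minimum.
have ellRin : {in box R n, ellR Q c =1 ellR_formula Q c}.
  by move=> x; rewrite inE => /ellRE.
have maxaff := max_affine_ellR_formula Q c.
split=> //.
- by move=> x xbox; rewrite ellRE//; exact: ellR_values_minimum.
- exact: piecewise_linear_max_affine polyhedron_box maxaff ellRin.
- exact: convex_function_max_affine convex_set_box maxaff ellRin.
Qed.
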